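(* Let $\mathscr{A}$ and $\mathscr{B}$ be two cross-intersecting Sperner families on $\mathbb{N}_n$, where $n\ge 3$ is an odd integer. Then $|\mathscr{A}|+|\mathscr{B}|=2\binom{n}{\lceil n/2\rceil}-1$ if and only if $\mathscr{A}=\binom{\mathbb{N}_n}{\lceil n/2\rceil}$, $\mathscr{B}\subset\binom{\mathbb{N}_n}{\lceil n/2\rceil}$ and $|\mathscr{B}|=\binom{n}{\lceil n/2\rceil}-1$.
   Context: For a positive integer $n$, $\mathbb{N}_n=\{1,2,\ldots,n\}$, and for $0\le k\le n$, $\binom{\mathbb{N}_n}{k}$ denotes the collection of all $k$-element subsets of $\mathbb{N}_n$. A Sperner family (or antichain) on $\mathbb{N}_n$ is a collection $\mathscr{F}$ of subsets of $\mathbb{N}_n$ such that $X\not\subseteq Y$ for all distinct $X,Y\in\mathscr{F}$. Two families $\mathscr{A},\mathscr{B}\subseteq 2^{\mathbb{N}_n}$ (where $2^{\mathbb{N}_n}$ is the power set of $\mathbb{N}_n$) are cross-intersecting if $A\cap B\neq\emptyset$ for all $A\in\mathscr{A}$ and all $B\in\mathscr{B}$.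
   Formalization: The printed equivalence fails when the roles of 𝒜 and ℬ are exchanged (n=3, 𝒜={{1,2},{1,3}}, ℬ all 2-subsets); the right-hand side is therefore stated up to exchanging 𝒜 and ℬ. *)

(* Defs.v *)
From mathcomp Require Import all_boot.

Set Implicit Arguments.
Unset Strict Implicit.
Unset Printing Implicit Defensive.

(* The ground set {1, ..., n} is represented by 'I_n = {0, ..., n-1}. *)

Definition sperner (n : nat) (F : {set {set 'I_n}}) : Prop :=
  forall X Y : {set 'I_n}, X \in F -> Y \in F -> X <> Y -> ~~ (X \subset Y).

Definition cross_intersecting (n : nat) (A B : {set {set 'I_n}}) : Prop :=
  forall X Y : {set 'I_n}, X \in A -> Y \in B -> X :&: Y <> set0.

Definition ksubsets (n k : nat) : {set {set 'I_n}} :=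
  [set X : {set 'I_n} | #|X| == k].

(* uphalf n is the ceiling of n / 2.  The condition is not symmetric in A and B,
   whereas being cross-intersecting Sperner families and #|A| + #|B| are: a
   characterization of equality has to allow both extremal_pair A B and
   extremal_pair B A. *)
Definition extremal_pair (n : nat) (A B : {set {set 'I_n}}) : Prop :=
  [/\ A = ksubsets n (uphalf n),
      B \proper ksubsets n (uphalf n)
    & #|B| = 'C(n, uphalf n) - 1].

(* Main.v *)
(** Let n = 2m + 1 and C = 'C(n, m + 1).  Replacing the sets of minimal size in
    an antichain by their upper shadow gives an antichain; below the middle it
    has no fewer sets, and at least two more when the minimal size is less than
    m.  Pushing up, taking complements and pushing up again bounds antichains by
    C, and the gain of two shows that an antichain with at least C - 1 sets only
    has sets of size m or m + 1.  Now let #|A| = C and #|B| = C - 1.  Pushing A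
    up from level m yields all (m + 1)-sets.  So if A had a set of size m, the
    complements of the members of B, none of which contains a member of A, would
    all be m-sets outside A; hence A would have a single m-set, although its m-sets
    have as many upper neighbours as members, and one m-set has m + 1 > 1 of them.
    So A consists of all (m + 1)-sets, which forces B into the same level. *)

Require Import Defs.
From mathcomp Require Import all_boot.
From mathcomp Require Import zify.

Set Implicit Arguments.
Unset Strict Implicit.
Unset Printing Implicit Defensive.

(** * Upper shadows and the local LYM inequality *)

Definition upshadow (T : finType) (G : {set {set T}}) : {set {set T}} :=
  [set Z : {set T} | [exists x in Z, Z :\ x \in G]].

Section Upshadow.
Variable T : finType.
Implicit Types (G : {set {set T}}) (X Z : {set T}).

Lemma upshadowP G Z :
  reflect (exists2 x, x \in Z & Z :\ x \in G) (Z \in upshadow G).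
Proof. by rewrite inE; apply: exists_inP. Qed.

Lemma setU1_upshadow G X x : X \in G -> x \notin X -> x |: X \in upshadow G.
Proof.
by move=> XG xX; apply/upshadowP; exists x; rewrite ?setU11 ?setU1K.
Qed.

Lemma leq_card_compl_upshadow G X : X \in G -> #|~: X| <= #|upshadow G|.
Proof.
move=> XG; have inj : {in ~: X &, injective (fun x => x |: X)}.
  move=> x y; rewrite !inE => xX yX /setP /(_ x).
  by rewrite !inE eqxx (negbTE xX) !orbF => /esym/eqP.
rewrite -(card_in_imset inj); apply/subset_leq_card/subsetP => _ /imsetP[x + ->].
by rewrite inE; apply: setU1_upshadow.
Qed.

(** Double counting: [P] pairs a member of [G] with a point outside it, [Q] a shadow set with a
    point inside it, and adding the point embeds [P] into [Q]. *)
Lemma local_LYM G j : (forall X, X \in G -> #|X| = j) ->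
  #|G| * (#|T| - j) <= #|upshadow G| * j.+1.
Proof.
move=> Gj.
pose P := [set p : {set T} * T | (p.1 \in G) && (p.2 \notin p.1)].
pose Q := [set p : {set T} * T | (p.1 \in upshadow G) && (p.2 \in p.1)].
have cardP : #|P| = #|G| * (#|T| - j).
  rewrite -sum1dep_card -(pair_big_dep (mem G) (fun X x => x \notin X)
    (fun _ _ => 1)) /= -sum_nat_const; apply: eq_bigr => X XG.
  have <- : #|~: X| = #|T| - j by rewrite cardsCs setCK Gj.
  by rewrite sum1dep_card; apply: eq_card => x; rewrite !inE.
have cardQ : #|Q| = #|upshadow G| * j.+1.
  rewrite -sum1dep_card -(pair_big_dep (mem (upshadow G)) (fun X x => x \in X)
    (fun _ _ => 1)) /= -sum_nat_const; apply: eq_bigr => Z /upshadowP[x xZ ZG].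
  by rewrite sum1_card (cardsD1 x) xZ (Gj _ ZG).
have inj : {in P &, injective (fun p : {set T} * T => (p.2 |: p.1, p.2))}.
  move=> [X x] [Y y]; rewrite !inE /= => /andP[_ xX] /andP[_ yY] [eXY exy].
  by rewrite -exy in eXY yY *; rewrite -(setU1K xX) eXY setU1K.
rewrite -cardP -cardQ -(card_in_imset inj).
apply/subset_leq_card/subsetP => _ /imsetP[[X x] + ->]; rewrite !inE /=.
case/andP=> XG xX; rewrite eqxx orTb andbT.
by have := setU1_upshadow XG xX; rewrite inE.
Qed.

End Upshadow.

(** * Replacing the lowest level of an antichain by its upper shadow *)

Definition push n (F : {set {set 'I_n}}) j :=
  (F :\: ksubsets n j) :|: upshadow (F :&: ksubsets n j).

Section Push.
Variables (n j : nat) (F : {set {set 'I_n}}).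
Hypotheses (spF : sperner F) (geF : forall X, X \in F -> j <= #|X|).

Let Fj := F :&: ksubsets n j.

Lemma card_upshadow_level Z : Z \in upshadow Fj -> #|Z| = j.+1.
Proof.
by case/upshadowP=> x xZ; rewrite !inE (cardsD1 x Z) xZ => /andP[_ /eqP->].
Qed.

Lemma pushP X :
  X \in push F j -> (X \in F /\ j < #|X|) \/ X \in upshadow Fj.
Proof.
rewrite inE => /orP[|]; last by right.
rewrite !inE => /andP[ne XF]; left; split=> //.
by rewrite ltn_neqAle eq_sym ne geF.
Qed.

Lemma push_card_gt X : X \in push F j -> j < #|X|.
Proof. by case/pushP=> [[]|/card_upshadow_level->]. Qed.

Lemma upshadow_level_subset Z Y :
  Z \in upshadow Fj -> Y \in F -> j < #|Y| -> ~~ (Z \subset Y).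
Proof.
case/upshadowP=> x xZ; rewrite !inE => /andP[ZF /eqP cZ] YF jY.
apply/negP=> ZY; have neq : Z :\ x <> Y by move=> e; rewrite -e cZ ltnn in jY.
by move/negP: (spF ZF YF neq); apply; apply: subset_trans ZY; apply: subD1set.
Qed.

Lemma push_sperner : sperner (push F j).
Proof.
move=> X Y /pushP[[XF jX]|XU] /pushP[[YF jY]|YU] neq.
- exact: spF.
- apply/negP=> XY; apply: neq; apply/eqP.
  by rewrite eqEcard XY (card_upshadow_level YU).
- exact: upshadow_level_subset.
- apply/negP=> XY; apply: neq; apply/eqP.
  by rewrite eqEcard XY (card_upshadow_level XU) (card_upshadow_level YU) /=.
Qed.

Lemma card_push : #|push F j| + #|Fj| = #|F| + #|upshadow Fj|.
Proof.
have dis : (F :\: ksubsets n j) :&: upshadow Fj = set0.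
  apply/eqP; rewrite -subset0; apply/subsetP=> Z.
  rewrite inE => /andP[/setDP[ZF _] ZU]; have := upshadow_level_subset ZU ZF.
  by rewrite (card_upshadow_level ZU) subxx => /(_ (ltnSn _)).
rewrite cardsU dis cards0 subn0.
by rewrite addnAC -(cardsID (ksubsets n j) F) -/Fj [#|Fj| + _]addnC.
Qed.

Lemma local_LYM_level : #|Fj| * (n - j) <= #|upshadow Fj| * j.+1.
Proof.
have := @local_LYM _ Fj j; rewrite card_ord; apply=> X.
by rewrite !inE => /andP[_ /eqP].
Qed.

(** Below the middle [n - j] is at least [j.+1], so the two factors in the local LYM inequality
    compare. *)
Lemma leq_card_upshadow_level : j.*2 < n -> #|Fj| <= #|upshadow Fj|.
Proof. move=> lt_jn; have := local_LYM_level; nia. Qed.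

Lemma leq_card_push : j.*2 < n -> #|F| <= #|push F j|.
Proof. by move=> /leq_card_upshadow_level; have := card_push; lia. Qed.

(* Both bounds on the upper shadow are needed: the local LYM inequality gains
   two sets when the level is large, a single member when it is small. *)
Lemma card_push_gain X :
  X \in F -> #|X| = j -> j.*2.+2 < n -> #|F| + 2 <= #|push F j|.
Proof.
move=> XF cX lt_jn.
have XFj : X \in Fj by rewrite !inE XF cX /=.
have := leq_card_compl_upshadow XFj; rewrite cardsCs setCK card_ord cX.
have := local_LYM_level; have := card_push.
suff: #|Fj| + 2 <= #|upshadow Fj| -> #|F| + 2 <= #|push F j| by nia.
have := card_push; lia.
Qed.

End Push.

(** * Iterated pushing and complementation *)

Section Sperner.
Variable n : nat.
Implicit Types F : {set {set 'I_n}}.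

(** Levels 0 to [k - 1] are pushed in turn; the hypothesis on [k] keeps each below the middle. The
    last clause lets a second lift, after complementation, end in a single level. *)
Lemma sperner_lift k F : k.*2 <= n.+1 -> sperner F ->
  exists F', [/\ sperner F', #|F| <= #|F'|,
    forall X, X \in F' -> k <= #|X| &
    forall b, k <= b -> (forall X, X \in F -> #|X| <= b) ->
      forall X, X \in F' -> #|X| <= b].
Proof.
elim: k => [|k IH] lek spF; first by exists F.
have [|F' [sp' le' ge' ub']] := IH _ spF; first lia.
exists (push F' k); split.
- exact: push_sperner.
- by apply: leq_trans le' _; apply: leq_card_push => //; lia.
- by move=> X; apply: push_card_gt.
- move=> b kb ubF X /(pushP ge')[[XF _]|/card_upshadow_level->//].
  by apply: (ub' b) XF => //; apply: ltnW.
Qed.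

Definition compls F := [set ~: X | X in F].

Lemma mem_compls F X : (X \in compls F) = (~: X \in F).
Proof. by rewrite -{1}(setCK X) (mem_imset _ _ (@setC_inj _)). Qed.

Lemma card_compls F : #|compls F| = #|F|.
Proof. by rewrite card_imset //; apply: setC_inj. Qed.

Lemma sperner_compls F : sperner F -> sperner (compls F).
Proof.
move=> spF X Y; rewrite !mem_compls => XF YF neq; rewrite -setCS.
by apply: spF => // /setC_inj e; apply: neq.
Qed.

Lemma card_ksubsets k : #|ksubsets n k| = 'C(n, k).
Proof. by rewrite card_draws card_ord. Qed.

End Sperner.

(** * Antichains of nearly maximal size for odd [n] *)

Section Odd.
Variable m : nat.
Let n := m.*2.+1.
Let nE : n = m.*2.+1 := erefl.
Let C := 'C(n, m.+1).
Implicit Types A B F : {set {set 'I_n}}.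

Lemma cardC_ord (X : {set 'I_n}) : #|~: X| = n - #|X|.
Proof. by rewrite cardsCs setCK card_ord. Qed.

Lemma leq_card_ord (X : {set 'I_n}) : #|X| <= n.
Proof. by rewrite (leq_trans (max_card _)) ?card_ord. Qed.

Lemma sperner_bound F : sperner F -> #|F| <= C.
Proof.
move=> spF.
have [|F1 [sp1 le1 ge1 _]] := sperner_lift (k := m.+1) _ spF; first lia.
have [|F2 [sp2 le2 ge2 ub2]] := sperner_lift (k := m) _ (sperner_compls sp1).
  lia.
rewrite (leq_trans le1) // -card_compls (leq_trans le2) //.
have -> : C = #|ksubsets n m|.
  by rewrite card_ksubsets /C -bin_sub /n; [congr 'C(_, _)|]; lia.
apply/subset_leq_card/subsetP => X XF; rewrite inE eqn_leq ge2 // andbT.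
(* Members of [F1] have at least [m.+1] points, so their complements have at most [m]. *)
apply: (ub2 m) XF => // {}X; rewrite mem_compls => /ge1.
rewrite cardC_ord /n; lia.
Qed.

Lemma large_sperner_card_ge F X :
  sperner F -> C - 1 <= #|F| -> X \in F -> m <= #|X|.
Proof.
move=> spF leF XF; rewrite leqNgt; apply/negP=> ltX.
have [Y YF minY] := arg_minnP (fun X : {set 'I_n} => #|X|) XF.
have ltYm : #|Y| < m := leq_ltn_trans (minY X XF) ltX.
have lt_n k : k < m -> k.*2.+2 < n by rewrite /n; lia.
have := sperner_bound (push_sperner spF minY).
have := card_push_gain spF YF erefl (lt_n _ ltYm).
have C_gt0 : 0 < C by rewrite bin_gt0 /n; lia.
lia.
Qed.

Lemma large_sperner_card F X : sperner F -> C - 1 <= #|F| -> X \in F ->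
  #|X| = m \/ #|X| = m.+1.
Proof.
move=> spF leF XF; have := large_sperner_card_ge spF leF XF.
(* The upper bound on the size of [X] is the lower bound for its complement. *)
have := @large_sperner_card_ge (compls F) (~: X) (sperner_compls spF).
rewrite card_compls mem_compls setCK cardC_ord => /(_ leF XF).
have := leq_card_ord X; have := nE; lia.
Qed.

Lemma cross_intersecting_sym A B :
  cross_intersecting A B -> cross_intersecting B A.
Proof. by move=> AB X Y XB YA; rewrite setIC; apply: AB. Qed.

Lemma cross_compls A B X Y :
  cross_intersecting A B -> X \in A -> Y \in compls B -> ~~ (X \subset Y).
Proof.
rewrite mem_compls => AB XA /(AB X _ XA) XY; apply/negP=> sXY; apply: XY.
by apply/disjoint_setI0; rewrite disjoints_subset setCK.
Qed.

Lemma extremal_pair_of_card A B : 0 < m -> sperner A -> sperner B ->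
  cross_intersecting A B -> #|A| = C -> #|B| = C - 1 -> extremal_pair A B.
Proof.
move=> m_gt0 spA spB AB cA cB.
have C_gt0 : 0 < C by rewrite bin_gt0 /n; lia.
have sizeA X : X \in A -> #|X| = m \/ #|X| = m.+1.
  by apply: large_sperner_card; rewrite // cA leq_subr.
have sizeB X : X \in B -> #|X| = m \/ #|X| = m.+1.
  by apply: large_sperner_card; rewrite // cB.
have geA X : X \in A -> m <= #|X| by move/sizeA; lia.
have uphn : uphalf n = m.+1 by rewrite /n /=; lia.
have pushA : push A m = ksubsets n m.+1.
  apply/eqP; rewrite eqEcard card_ksubsets -/C -cA leq_card_push //.
  rewrite andbT; apply/subsetP=> X /(pushP geA)[[/sizeA + ltX]|].
    by rewrite inE => -[e|/eqP//]; rewrite e ltnn in ltX.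
  by move/card_upshadow_level; rewrite inE => ->.
have Am0 X : X \in A -> #|X| = m.+1.
  move=> XA; have [cX|//] := sizeA _ XA; exfalso.
  have XAm : X \in A :&: ksubsets n m by rewrite !inE XA cX /=.
  have := leq_card_compl_upshadow XAm; rewrite cardC_ord cX.
  (* As [push A m] and [A] both have [C] members, the [m]-sets of [A] are as many as their upper
     neighbours, hence at least [m.+1]; the inclusion below allows only one. *)
  have := card_push m spA; rewrite pushA card_ksubsets -/C cA.
  suff : compls B \subset ksubsets n m :\: A.
    have := subset_leq_card (subsetIr A (ksubsets n m)).
    move=> leAm /subset_leq_card; move: leAm.
    rewrite card_compls cB cardsD card_ksubsets [_ :&: A]setIC.
    have -> : 'C(n, m) = C by rewrite /C -bin_sub /n; [congr 'C(_, _)|]; lia.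
    move: #|A :&: _| #|upshadow _| => a u; have := nE; lia.
  apply/subsetP=> Y YB; rewrite !inE; apply/andP; split.
    by apply/negP=> YA; have := cross_compls AB YA YB; rewrite subxx.
  have [->//|cY] : #|Y| = m \/ #|Y| = m.+1.
    move: YB; rewrite mem_compls => /sizeB; rewrite cardC_ord.
    have := leq_card_ord Y; have := nE; lia.
  (* An [m.+1]-set is in [A] or contains an [m]-set of [A]; a member of [compls B] can do
     neither. *)
  have : Y \in push A m by rewrite pushA inE cY.
  case/(pushP geA)=> [[YA _]|/upshadowP[y yY]].
    by have := cross_compls AB YA YB; rewrite subxx.
  rewrite inE => /andP[YyA _].
  by have := cross_compls AB YyA YB; rewrite subD1set.
have eA : A = ksubsets n m.+1.
  apply/eqP; rewrite eqEcard card_ksubsets -/C cA leqnn andbT.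
  by apply/subsetP=> X /Am0 cX; rewrite inE cX.
rewrite /extremal_pair uphn; split=> //.
rewrite properEcard card_ksubsets -/C cB subn1 ltn_predL C_gt0 andbT.
apply/subsetP=> Y YB; rewrite inE; have [cY|->//] := sizeB _ YB.
(* An [m]-set in [B] would be disjoint from its complement, an [m.+1]-set and so a member of [A]. *)
have cYA : ~: Y \in A by rewrite eA inE cardC_ord cY; have := nE; lia.
by have := AB _ _ cYA YB; rewrite setIC setICr.
Qed.

End Odd.

Theorem theorem1p5 (n : nat) (A B : {set {set 'I_n}})
    (n_ge3 : 3 <= n) (n_odd : odd n)
    (A_sperner : sperner A) (B_sperner : sperner B)
    (AB_cross : cross_intersecting A B) :
  #|A| + #|B| = 2 * 'C(n, uphalf n) - 1 <->
  extremal_pair A B \/ extremal_pair B A.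
Proof.
have [m en] : exists m, n = m.*2.+1.
  by exists n./2; rewrite -{1}(odd_double_half n) n_odd.
subst n; have m_gt0 : 0 < m by lia.
have uphn : uphalf m.*2.+1 = m.+1 by rewrite /=; lia.
have C_gt0 : 0 < 'C(m.*2.+1, m.+1) by rewrite bin_gt0; lia.
split=> [|[] [-> _ ->]]; rewrite ?card_ksubsets uphn; try lia.
move=> cAB.
have := sperner_bound A_sperner; have := sperner_bound B_sperner => leB leA.
have [cA|cB] : #|A| = 'C(m.*2.+1, m.+1) \/ #|B| = 'C(m.*2.+1, m.+1) by lia.
- by left; apply: extremal_pair_of_card => //; lia.
- by right; apply: extremal_pair_of_card => //; [exact: cross_intersecting_sym|lia].
Qed.
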